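(* Let $u_1,u_2,u_3$ be non-commutator words involving pairwise disjoint sets of variables. Then the word $[u_1,u_2,u_3]$ is concise; that is, for every group $G$ such that the set $G_w$ of values of $w=[u_1,u_2,u_3]$ in $G$ is finite, the verbal subgroup $w(G)$ is finite.
   Context: For a group-word $w=w(x_1,\dots,x_k)$ (an element of the free group on $x_1,\dots,x_k$) and a group $G$, $G_w=\{w(g_1,\dots,g_k): g_i\in G\}$ is the set of $w$-values in $G$, and $w(G)=\langle G_w\rangle$ is the verbal subgroup. A word $w$ is concise if $w(G)$ is finite for every group $G$ such that $G_w$ is finite. A non-commutator word is a word such that the sum of the exponents of some variable involved in it is non-zero. Commutators are $[x,y]=x^{-1}y^{-1}xy$ and are left-normed: $[x,y,z]=[[x,y],z]$. *)

(* Defs.v *)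
From HB Require Import structures.
From mathcomp Require Import all_boot all_algebra.
From mathcomp Require Import all_classical.

Set Implicit Arguments.
Unset Strict Implicit.
Unset Printing Implicit Defensive.

Local Open Scope classical_set_scope.
Local Open Scope group_scope.

(* The free group on X, realised as the freely reduced words over X. The      *)
(* letter (x, false) stands for x, and (x, true) for x^-1.                    *)
Section FreeGroup.
Variable X : choiceType.

Implicit Types (l : X * bool) (s : seq (X * bool)).

Definition letter_inv l : X * bool := (l.1, ~~ l.2).

Definition reduced s : bool := sorted (fun l l' => l' != letter_inv l) s.

Record freeGroup := FreeGroup { fg_word :> seq (X * bool); _ : reduced fg_word }.

HB.instance Definition _ := [isSub for fg_word].
HB.instance Definition _ := [Choice of freeGroup by <:].

(* Left multiplication of a reduced word by a letter. *)
Definition push l s :=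
  if s is l' :: s' then if l' == letter_inv l then s' else l :: s else [:: l].

Lemma letter_invK : involutive letter_inv.
Proof. by case=> x b; rewrite /letter_inv /= negbK. Qed.

Lemma reduced_push l s : reduced s -> reduced (push l s).
Proof.
case: s => [//|l' s] /=; case: eqP => [_|/eqP ne] /=; first exact: path_sorted.
by rewrite ne.
Qed.

Lemma reduced_foldr s t : reduced t -> reduced (foldr push t s).
Proof. by move=> rt; elim: s => //= l s; apply: reduced_push. Qed.

Lemma pushK l s : reduced s -> push l (push (letter_inv l) s) = s.
Proof.
case: s => [|l' s] /=; first by rewrite eqxx.
rewrite letter_invK; case: (eqVneq l' l) => [-> | _]; last by rewrite /= eqxx.
by case: s => [//|l'' s] /= /andP[/negPf-> _].
Qed.

Lemma foldr_push_push l s t : reduced t ->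
  foldr push t (push l s) = push l (foldr push t s).
Proof.
move=> rt; case: s => [//|l' s] /=; case: eqP => [->|//].
by rewrite pushK // reduced_foldr.
Qed.

Lemma foldr_push_nil s : reduced s -> foldr push [::] s = s.
Proof.
elim: s => [//|l s IH] rs /=; have -> := IH (path_sorted rs).
by case: s rs {IH} => [//|l' s] /= /andP[/negPf-> _].
Qed.

Definition word_inv s := rev (map letter_inv s).

Lemma word_invK : involutive word_inv.
Proof.
by move=> s; rewrite /word_inv map_rev revK -map_comp map_id_in // => l _ /=;
  rewrite letter_invK.
Qed.

Lemma reduced_inv s : reduced s -> reduced (word_inv s).
Proof.
rewrite /reduced /word_inv rev_sorted sorted_map; apply: sub_sorted => l l' /=.
by apply: contraNN => /eqP->; rewrite letter_invK.
Qed.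

Lemma foldr_push_inv s : reduced s -> foldr push s (word_inv s) = [::].
Proof.
elim: s => [//|l s IH] rs; rewrite /word_inv /= rev_cons foldr_rcons /=.
by rewrite letter_invK eqxx; apply: IH (path_sorted rs).
Qed.

Lemma fg_reduced (u : freeGroup) : reduced u.
Proof. by case: u. Qed.

Definition fg_one : freeGroup := @FreeGroup [::] isT.
Definition fg_mul (u v : freeGroup) : freeGroup :=
  FreeGroup (reduced_foldr u (fg_reduced v)).
Definition fg_inv (u : freeGroup) : freeGroup :=
  FreeGroup (reduced_inv (fg_reduced u)).

Lemma fg_mulA : associative fg_mul.
Proof.
move=> u v w; apply: val_inj => /=.
elim: (fg_word u) => [//|l s /= ->].
by rewrite foldr_push_push // fg_reduced.
Qed.

Lemma fg_mul1g : left_id fg_one fg_mul.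
Proof. by move=> u; apply: val_inj. Qed.

Lemma fg_mulg1 : right_id fg_one fg_mul.
Proof. by move=> u; apply: val_inj; rewrite /= foldr_push_nil ?fg_reduced. Qed.

Lemma fg_mulVg : left_inverse fg_one fg_inv fg_mul.
Proof. by move=> u; apply: val_inj; rewrite /= foldr_push_inv ?fg_reduced. Qed.

Lemma fg_mulgV : right_inverse fg_one fg_inv fg_mul.
Proof.
move=> u; apply: val_inj => /=; rewrite -[X in foldr _ _ X]word_invK.
by rewrite foldr_push_inv // reduced_inv // fg_reduced.
Qed.

HB.instance Definition _ := isGroup.Build freeGroup
  fg_mulA fg_mul1g fg_mulg1 fg_mulVg fg_mulgV.

(* Since fg_word u is reduced, these are the variables genuinely involved. *)
Definition vars (u : freeGroup) : set X := [set x | x \in map fst (fg_word u)].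

Definition exponent_sum (u : freeGroup) (x : X) : int :=
  (\sum_(l <- fg_word u | l.1 == x) (if l.2 then -1 else 1))%R.

Definition non_commutator (u : freeGroup) : Prop :=
  exists2 x, vars u x & exponent_sum u x <> 0%R.

Section Evaluation.
Variables (G : groupType) (g : X -> G).

Definition letter_eval l : G := if l.2 then (g l.1)^-1 else g l.1.

Definition word_eval (u : freeGroup) : G :=
  \big[*%g/1]_(l <- fg_word u) letter_eval l.

Lemma letter_evalV l : letter_eval (letter_inv l) = (letter_eval l)^-1.
Proof. by case: l => x []; rewrite /letter_eval //= invgK. Qed.

Lemma word_evalM : {morph word_eval : u v / u * v}.
Proof.
move=> u v; rewrite /word_eval /=.
elim: (fg_word u) => [|l s /= IH]; first by rewrite big_nil mul1g.
rewrite big_cons -mulgA -{}IH.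
case: (foldr push v s) => [|l' t] /=; first by rewrite big_cons.
case: eqP => [->|_]; last by rewrite big_cons.
by rewrite big_cons letter_evalV mulVKg.
Qed.

Lemma word_eval1 : word_eval 1 = 1.
Proof. exact: big_nil. Qed.

HB.instance Definition _ :=
  isUMagmaMorphism.Build freeGroup G word_eval (conj word_eval1 word_evalM).

End Evaluation.

End FreeGroup.

Definition generated_subgroup (G : groupType) (A : set G) : set G :=
  smallest [set H : set G | group_closed (mem H)] A.

(* A word involves finitely many variables, so letting g range over all       *)
(* assignments X -> G yields the same values as ranging over tuples.          *)
Definition word_values (X : choiceType) (w : freeGroup X) (G : groupType) :
  set G := range (fun g : X -> G => word_eval g w).
Arguments word_values {X} w G _.

Definition verbal_subgroup (X : choiceType) (w : freeGroup X) (G : groupType) :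
  set G := generated_subgroup (word_values w G).
Arguments verbal_subgroup {X} w G _.

Definition concise (X : choiceType) (w : freeGroup X) : Prop :=
  forall G : groupType,
    finite_set (word_values w G) -> finite_set (verbal_subgroup w G).

(* Main.v *)
(* Let A1, A2, A3 be the value sets of u1, u2, u3: they are closed under
   conjugation and contain all e-th powers for some e > 0.  Let W be the finite
   set of all [a1, a2, a3].  Letting one entry run through the powers of an
   element, the pigeonhole principle yields N > 0 such that g^N commutes with
   every [a1, a2], and [g^N, a2] and [a1, g^N] commute with every a3.  In
   particular the N-th powers of elements of W are central in <W>.

   Let x = [a1, a2].  Modulo torsion in <W>, the value [x, a3] has N-th multiple
   [x^N, a3], which does not change when x is replaced by its conjugate under
   a2^i, because [x^N, a2^i] commutes with a3.  As [a1, a2^N] is the product of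
   the conjugates of x under a2^i for i < N and commutes with a3, [x, a3] is
   torsion.  So W is a finite set of torsion elements closed under conjugation,
   and <W> is finite by Dietzmann's lemma. *)
Require Import Defs.
From mathcomp Require Import all_boot all_algebra.
From mathcomp Require Import all_classical.

Local Open Scope classical_set_scope.
Local Open Scope group_scope.

(** * Finiteness: pigeonhole and words of bounded length *)

(** Two equal terms among the first [(size s).+1] lie at distance at most [size s], which divides
    the factorial; hence one [M] serves all sequences. *)
Lemma finite_set_pigeonhole (T : eqType) (S : set T) : finite_set S ->
  exists2 M : nat, 0 < M & forall f : nat -> T, (forall k, S (f k)) ->
    exists k d, [/\ 0 < d, d %| M & f (k + d)%N = f k].
Proof.
case/finite_seqP=> s ->; exists (size s)`!; first exact: fact_gt0.
move=> f fS; have : ~~ uniq (mkseq f (size s).+1).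
  apply/negP => uf; have := @uniq_leq_size _ _ s uf.
  rewrite size_mkseq ltnn => H; suff: false by []; apply: H.
  by move=> x /mapP[k _ ->]; apply: fS.
case/(uniqPn (f 0%N)) => i [j []] lt_ij; rewrite size_mkseq => lt_js.
rewrite !nth_mkseq ?(ltn_trans lt_ij) // => eq_f.
exists i, (j - i); split; first by rewrite subn_gt0.
  by rewrite dvdn_fact // subn_gt0 lt_ij /= (leq_trans (leq_subr _ _)).
by rewrite subnKC // ltnW.
Qed.

Lemma finite_set_words (T : choiceType) (A : seq T) (b : nat) :
  finite_set [set s : seq T | all (mem A) s /\ size s <= b].
Proof.
elim: b => [|b IH].
  apply: (@sub_finite_set _ _ [set [::]]); last exact: finite_set1.
  by case=> [|x s] [].
apply: (@sub_finite_set _ _ ([set [::]] `|`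
    [set x :: s | x in [set` A] & s in [set s : seq T | all (mem A) s /\ size s <= b]])).
  case=> [|x s]; first by left.
  case=> /= /andP[Ax As] sz; right; exists x => //; exists s => //.
rewrite finite_setU; split; first exact: finite_set1.
by apply: finite_image2 => //; apply/finite_seqP; exists A.
Qed.

Lemma commgMg (G : groupType) (x y z : G) :
  [~ x * y, z] = [~ x, z] ^ y * [~ y, z].
Proof. by rewrite /commg /conjg !invgM !mulgA !(mulgK, mulgVK). Qed.

Lemma commgM (G : groupType) (x y z : G) :
  [~ x, y * z] = [~ x, z] * [~ x, y] ^ z.
Proof. by rewrite /commg /conjg !invgM !mulgA !(mulgK, mulgVK). Qed.

Lemma conjg_commute (G : groupType) (x y : G) : commute x y -> x ^ y = x.
Proof. by move=> cxy; apply/conjg_fixP/commgP. Qed.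

(** * Collection of powers over a finite conjugation-closed set *)

Section Collection.

Context {G : groupType} (W : seq G) (n : nat).
Hypothesis n_gt0 : 0 < n.
Hypothesis W_conj : forall t u, t \in W -> u \in W -> t ^ u \in W.
Hypothesis W_cent : forall t u, t \in W -> u \in W -> commute (t ^+ n) u.

(** Defined on words, since [t -> t ^+ n] is not known to extend to a homomorphism. *)
Definition prod_powers (s : seq G) : G := \prod_(t <- s) t ^+ n.

Lemma commute_prod_powers (z : G) (s : seq G) : all (mem W) s ->
  (forall t, t \in W -> commute z t) -> commute z (prod_powers s).
Proof.
move=> sW zW; rewrite /prod_powers big_seq; apply: commute_prod => t ts.
by apply: commuteX; apply: zW; exact: (allP sW).
Qed.

(* Moving [t] to the left past [u] turns [u] into [u ^ t], which has the same *)
(* central [n]-th power. *)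
Lemma collect_letter (s : seq G) (t : G) : all (mem W) s -> t \in s ->
  exists s', [/\ all (mem W) s', \prod_(u <- s) u = t * \prod_(u <- s') u,
    prod_powers s = t ^+ n * prod_powers s', size s = (size s').+1 &
    count_mem t s = (count_mem t s').+1].
Proof.
elim: s => // u s IH /= /andP[uW sW].
case: (eqVneq u t) => [-> _|ne_ut].
  by exists s; rewrite /prod_powers !big_cons add1n.
rewrite inE eq_sym (negPf ne_ut) /= => ts.
have tW : t \in W by apply: (allP sW).
have [s' [s'W es ep esz ec]] := IH sW ts.
exists (u ^ t :: s'); rewrite /prod_powers !big_cons -/(prod_powers _).
split=> /=.
- by rewrite s'W andbT; apply: W_conj.
- by rewrite es [RHS]mulgA -conjgC mulgA.
- rewrite -/(prod_powers s) ep -conjXg (conjg_commute _ _ _ (W_cent _ _ uW tW)) !mulgA.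
  by congr (_ * _); apply: commuteX; apply: W_cent.
- by rewrite esz.
(* Conjugation by [t] fixes [t], so no other letter turns into [t]. *)
- suff -> : (u ^ t == t) = false by rewrite add0n ec.
  apply/negbTE; apply: contra ne_ut => /eqP e.
  by apply/eqP/(conjg_inj t); rewrite e (conjg_commute _ t t).
Qed.

Lemma collect_power (s : seq G) (t : G) (k : nat) : all (mem W) s ->
  k <= count_mem t s ->
  exists s', [/\ all (mem W) s', \prod_(u <- s) u = t ^+ k * \prod_(u <- s') u,
    prod_powers s = (t ^+ n) ^+ k * prod_powers s' & size s = (k + size s')%N].
Proof.
elim: k s => [|k IH] s sW le_k; first by exists s; rewrite !expg0 !mul1g.
have ts : t \in s by rewrite -has_pred1 has_count; exact: leq_trans le_k.
have [s1 [s1W e1 p1 sz1 c1]] := collect_letter _ _ sW ts.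
have [|s2 [s2W e2 p2 sz2]] := IH s1 s1W; first by rewrite -ltnS -c1.
exists s2; split=> //; first by rewrite e1 e2 mulgA expgS.
  by rewrite p1 p2 mulgA expgS.
by rewrite sz1 sz2.
Qed.

Lemma long_word_repeats (s : seq G) : all (mem W) s -> size W * n < size s ->
  exists2 t, t \in W & n <= count_mem t s.
Proof.
move=> sW lt_s; case: (boolP (has (fun t => n <= count_mem t s) W)).
  by case/hasP=> t; exists t.
(* Only an inequality, as [W] may list an element twice. *)
move/hasPn=> few; have : size s <= \sum_(t <- W) count_mem t s.
  elim: s sW {lt_s few} => //= x s IH /andP[xW /IH le_s].
  rewrite big_split /= -add1n leq_add // {IH le_s}.
  by elim: W xW => //= t W' IH; rewrite inE big_cons; case: eqVneq => //= _ /IH.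
rewrite leqNgt => /negP[]; apply: leq_ltn_trans lt_s.
elim: (W) few => [|t W' IH] few; first by rewrite big_nil.
rewrite big_cons mulSn leq_add //; last first.
  by apply: IH => u uW'; apply: few; rewrite inE uW' orbT.
by apply: ltnW; rewrite ltnNge; apply: few; rewrite mem_head.
Qed.

(** While the word is too long, some letter [t] occurs [n] times. Pulling out these occurrences adds
    [t] to [r]; they contribute [t ^+ n] to the product but [(t ^+ n) ^+ n] to [prod_powers], whence
    the outer exponent [n]. *)
Lemma collect (s : seq G) : all (mem W) s ->
  exists r s', [/\ all (mem W) r, all (mem W) s', size s' <= size W * n,
    \prod_(u <- s) u = prod_powers r * \prod_(u <- s') u &
    prod_powers s = prod_powers r ^+ n * prod_powers s'].
Proof.
have [m] := ubnP (size s); elim: m s => // m IH s lt_m sW.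
have [short|long] := leqP (size s) (size W * n).
  exists [::], s; split=> //; rewrite /prod_powers big_nil ?mul1g //.
  by rewrite expg1n mul1g.
have [t tW le_n] := long_word_repeats _ sW long.
have [s1 [s1W e1 p1 sz1]] := collect_power _ _ _ sW le_n.
have [|r [s2 [rW s2W short e2 p2]]] := IH s1 _ s1W.
  rewrite -ltnS; apply: leq_trans lt_m; rewrite ltnS sz1.
  by rewrite -[X in X < _]add0n ltn_add2r.
exists (t :: r), s2; rewrite /prod_powers big_cons -!/(prod_powers _).
split=> //=; first by rewrite tW.
  by rewrite e1 e2 mulgA.
rewrite p1 p2 mulgA expgMn //.
by apply: commute_prod_powers => // u uW; apply: W_cent.
Qed.

(* Replaces the transfer into the centre: up to torsion, [t -> t ^+ n] extends to *)
(* a homomorphism on the subgroup generated by [W], which is [q -> q ^+ n] on the  *)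
(* centre.  Collecting the powers of [s] leaves remainders of bounded length, so   *)
(* two of these powers have the same remainder. *)
Lemma prod_powers_central : exists2 K : nat, 0 < K &
  forall (s : seq G) (q : G), all (mem W) s -> \prod_(t <- s) t = q ->
    (forall t, t \in W -> commute q t) -> prod_powers s ^+ K = q ^+ (n * K).
Proof.
have [K K_gt0 pigeon] := finite_set_pigeonhole _ _ (finite_set_words _ W (size W * n)).
exists K => // s q sW es qW.
have pow k : exists rs : seq G * seq G, [/\ all (mem W) rs.1, all (mem W) rs.2,
    size rs.2 <= size W * n,
    q ^+ k = prod_powers rs.1 * \prod_(u <- rs.2) u &
    prod_powers s ^+ k = prod_powers rs.1 ^+ n * prod_powers rs.2].
  have [|r [s' [rW s'W le_s' e p]]] := collect (flatten (nseq k s)).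
    by elim: k => //= k IH; rewrite all_cat sW.
  exists (r, s'); split=> //=.
    by rewrite -e; elim: {e p} k => [|k IH]; rewrite ?big_nil // expgS IH /= big_cat es.
  rewrite -p; elim: {e p} k => [|k IH]; first by rewrite /prod_powers big_nil.
  by rewrite expgS IH /prod_powers /= big_cat.
have [rs rsP] := choice pow.
have [|k [d [d_gt0 dvd_d eq_rs]]] := pigeon (fun k => (rs k).2).
  by move=> k; have [] := rsP k.
have [rW _ _ ek pk] := rsP k; have [rW' _ _ ekd pkd] := rsP (k + d)%N.
(* Cancelling the common remainder expresses [q ^+ d] through the collected parts; comparing their
   [n]-th powers gives [prod_powers s ^+ d = (q ^+ d) ^+ n]. *)
rewrite eq_rs addnC !expgnDr in ekd pkd.
rewrite ek mulgA in ekd; move/mulIg: ekd => ekd.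
rewrite pk -ekd expgMn in pkd; last first.
  by apply: commute_prod_powers => // t tW; apply/commute_sym/commuteX/commute_sym/qW.
rewrite !mulgA in pkd; move/mulIg/mulIg: pkd => pkd.
by rewrite -(divnK dvd_d) [(_ %/ _ * _)%N]mulnC expgnA pkd -!expgnA mulnCA.
Qed.

End Collection.

(** Dietzmann's lemma: the collected powers are trivial, so every product equals one of bounded
    length. Products are closed under inverses because [t^-1 = t ^+ n.-1]. *)
Lemma finite_generated_torsion (G : groupType) (W : seq G) (n : nat) : 0 < n ->
  (forall t u, t \in W -> u \in W -> t ^ u \in W) ->
  (forall t, t \in W -> t ^+ n = 1) ->
  finite_set (generated_subgroup [set` W]).
Proof.
move=> n_gt0 W_conj W_tors.
have W_cent t u : t \in W -> u \in W -> commute (t ^+ n) u.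
  by move=> /W_tors-> _; apply/commute_sym/commute1.
pose H := [set x | exists2 s, all (mem W) s & \prod_(t <- s) t = x].
apply: (@sub_finite_set _ _ H); last first.
  apply: sub_finite_set (finite_image (fun s => \prod_(t <- s) t)
    (finite_set_words _ W (size W * n))) => x [s sW <-].
  have [r [s' [rW s'W short -> _]]] := collect W n n_gt0 W_conj W_cent s sW.
  exists s'; first by split.
  suff -> : prod_powers n r = 1 by rewrite mul1g.
  rewrite /prod_powers big_seq big1 // => t tr.
  by apply: W_tors; apply: (allP rW).
apply: smallest_sub => [|t tW]; last by exists [:: t]; rewrite /= ?andbT // big_seq1.
split=> [|x y]; first by rewrite inE; exists [::]; rewrite // big_nil.
rewrite !inE => -[s sW <-] [s' s'W <-].
suff [r rW <-] : H (\prod_(t <- s') t)^-1.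
  by exists (s ++ r); rewrite ?all_cat ?sW ?big_cat.
elim: s' s'W => [_|t s' IH /= /andP[tW /IH[r rW er]]].
  by exists [::]; rewrite // !big_nil invg1.
exists (r ++ nseq n.-1 t); first by rewrite all_cat rW all_nseq /= tW orbT.
rewrite big_cons invgM big_cat /= er; congr (_ * _).
rewrite big_nseq iter_mulg_1; apply/esym/mulg1_eq.
by rewrite -expgS prednK ?W_tors.
Qed.

(** * Powers inside commutators and torsion of triple commutators *)

Lemma commXg_commute (G : groupType) (x y : G) (n : nat) :
  commute x [~ x, y] -> [~ x ^+ n, y] = [~ x, y] ^+ n.
Proof.
move=> cxy; elim: n => [|n IH]; first by rewrite comm1g.
rewrite expgS commgMg IH conjg_commute -?expgS //.
by apply: commuteX; apply: commute_sym.
Qed.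

Lemma commgX_commute (G : groupType) (x y : G) (n : nat) :
  commute y [~ x, y] -> [~ x, y ^+ n] = [~ x, y] ^+ n.
Proof.
move=> cxy; elim: n => [|n IH]; first by rewrite commg1.
rewrite expgS commgM IH conjg_commute -?expgSr //.
by apply: commuteX; apply: commute_sym.
Qed.

Section TripleCommutators.

Context {G : groupType} (A1 A2 A3 : set G) (e : nat).
Hypothesis e_gt0 : 0 < e.
Hypotheses (A1J : forall a g, A1 a -> A1 (a ^ g))
  (A2J : forall a g, A2 a -> A2 (a ^ g)) (A3J : forall a g, A3 a -> A3 (a ^ g)).
Hypotheses (A1X : forall g, A1 (g ^+ e)) (A2X : forall g, A2 (g ^+ e))
  (A3X : forall g, A3 (g ^+ e)).

Definition triple_values : set G :=
  [set x | exists a1 a2 a3, [/\ A1 a1, A2 a2, A3 a3 & x = [~ a1, a2, a3]]].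

Hypothesis fin_values : finite_set triple_values.

Lemma triple_valuesJ (x g : G) : triple_values x -> triple_values (x ^ g).
Proof.
case=> a1 [a2 [a3 [h1 h2 h3 ->]]]; exists (a1 ^ g), (a2 ^ g), (a3 ^ g).
by split; rewrite ?conjRg; auto.
Qed.

Definition triple_exponent (N : nat) : Prop :=
  [/\ 0 < N,
    forall g a1 a2, A1 a1 -> A2 a2 -> commute (g ^+ N) [~ a1, a2],
    forall g a2 a3, A2 a2 -> A3 a3 -> commute [~ g ^+ N, a2] a3 &
    forall g a1 a3, A1 a1 -> A3 a3 -> commute [~ a1, g ^+ N] a3].

Lemma triple_exponent_exists : exists N, triple_exponent N.
Proof.
have [M M_gt0 pigeon] := finite_set_pigeonhole _ _ fin_values.
have cent g a1 a2 : A1 a1 -> A2 a2 -> commute (g ^+ (e * M)) [~ a1, a2].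
  move=> h1 h2.
  have [|k [d [_ dvd_d eq_k]]] := pigeon (fun k => [~ a1, a2, (g ^+ k) ^+ e]).
    by move=> k; exists a1, a2, ((g ^+ k) ^+ e).
  move/mulgI: eq_k; rewrite addnC expgnDr expgMn; last exact: commuteX2.
  rewrite conjgM => /conjg_inj/conjg_fixP/commgP/commute_sym.
  rewrite -(divnK dvd_d) -expgnA [(d * e)%N]mulnC => cgd.
  rewrite [(_ %/ _ * _)%N]mulnC mulnA expgnA.
  exact/commute_sym/commuteX/commute_sym.
have cent3 v a3 : (forall k, triple_values [~ v ^+ k, a3]) -> commute (v ^+ M) a3.
  move=> /pigeon[k [d [_ dvd_d]]].
  rewrite addnC expgnDr commgMg -[RHS]mul1g => /mulIg/eqP.
  rewrite conjg_eq1 => /commgP cvd.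
  by rewrite -(divnK dvd_d) mulnC expgnA; apply/commute_sym/commuteX/commute_sym.
have pX (g : G) k : (g ^+ (e * M)) ^+ k = (g ^+ (M * k)) ^+ e.
  by rewrite -!expgnA -mulnA mulnC.
(* By [cent], [h = g ^+ (e * M)] commutes with [[~ h, a2]] and [[~ a1, h]], so their powers are
   again such commutators, with [h ^+ k] an [e]-th power. Then [cent3] applies and costs the second
   [M]. *)
exists (e * M * M)%N; split; first by rewrite !muln_gt0 e_gt0 M_gt0.
- move=> g a1 a2 h1 h2; rewrite expgnA.
  by apply/commute_sym/commuteX/commute_sym/cent.
- move=> g a2 a3 h2 h3; have cp : commute (g ^+ (e * M)) [~ g ^+ (e * M), a2].
    by apply: cent => //; rewrite -[_ ^+ (e * M)]expg1 pX.
  rewrite expgnA commXg_commute //; apply: cent3 => k.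
  exists ((g ^+ (M * k)) ^+ e), a2, a3; split=> //.
  by rewrite -pX commXg_commute.
- move=> g a1 a3 h1 h3; have cp : commute (g ^+ (e * M)) [~ a1, g ^+ (e * M)].
    by apply: cent => //; rewrite -[_ ^+ (e * M)]expg1 pX.
  rewrite expgnA commgX_commute //; apply: cent3 => k.
  exists a1, ((g ^+ (M * k)) ^+ e), a3; split=> //.
  by rewrite -pX commgX_commute.
Qed.

Lemma triple_values_torsion :
  exists2 n : nat, 0 < n & forall c, triple_values c -> c ^+ n = 1.
Proof.
have [N [N_gt0 cent cent2 cent1]] := triple_exponent_exists.
have /finite_seqP[W eW] := fin_values.
have memW t : (t \in W) <-> triple_values t by rewrite eW.
(* [[a1, a2, a3]] is [[a1, a2]^-1] times [[a1 ^ a3, a2 ^ a3]], and [cent] covers both. *)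
have centW g t : t \in W -> commute (g ^+ N) t.
  move/memW=> [a1 [a2 [a3 [h1 h2 h3 ->]]]]; rewrite commgEl.
  apply: commuteM; first by apply/commuteV/cent.
  by rewrite conjRg; apply: cent; auto.
have W_conj t u : t \in W -> u \in W -> t ^ u \in W.
  by move=> /memW tW _; apply/memW; apply: triple_valuesJ.
have W_cent t u : t \in W -> u \in W -> commute (t ^+ N) u by move=> _; apply: centW.
have [K K_gt0 transfer] := prod_powers_central W N N_gt0 W_conj W_cent.
(* The factor [N * N * K] takes each [u i] to [q ^+ (N * K)]; the last [N] counts the conjugates
   whose product is [[a1, b ^+ N]]. *)
exists (N * N * K * N)%N; first by rewrite !muln_gt0 N_gt0 K_gt0.
move=> _ [a1 [b [a3 [h1 h2 h3 ->]]]].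
pose x i := [~ a1, b] ^ (b ^+ i); pose u i := [~ x i, a3].
pose q := [~ x 0 ^+ N, a3].
(* The words for [[~ x i ^+ N, a3] = q] and for [[~ a1, b ^+ N, a3] = 1] have *)
(* images a power of [u i] and a product of powers of all the [u i]: together *)
(* they force [q], hence every [u i], to be torsion. *)
have centx g i : commute (g ^+ N) (x i) by rewrite /x conjRg; apply: cent; auto.
have centxX g i k : commute (g ^+ N) (x i ^+ k) by apply: commuteX.
have uW i : u i \in W.
  apply/memW; exists (a1 ^ (b ^+ i)), (b ^ (b ^+ i)), a3.
  by split; rewrite -?conjRg; auto.
have xS i : x i.+1 = x i ^ b by rewrite /x expgSr conjgM.
(* Since [[y, b]] commutes with [a3], passing from [y] to [y * [y, b]] only conjugates [[y, a3]] by
   [[y, b]]. This is trivial: [[y, a3]] is a product of [N]-th powers and inverses of such, which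
   commute with every [x i]. *)
have qE i : [~ x i ^+ N, a3] = q.
  elim: i => // i IH; set y := x i ^+ N.
  have -> : x i.+1 ^+ N = y * [~ y, b] by rewrite commgEl mulVKg xS conjXg.
  rewrite commgMg IH; have /commgP/eqP-> := cent2 (x i) _ _ h2 h3.
  have -> : [~ y, b] = y^-1 * x i.+1 ^+ N by rewrite commgEl xS conjXg.
  rewrite mulg1 -IH -/y conjg_commute // commgEl.
  have pow g : commute (g ^+ N) (y^-1 * x i.+1 ^+ N).
    by apply: commuteM; first apply: commuteV; apply: centxX.
  apply/commute_sym/commuteM; last by rewrite conjXg; apply/commute_sym/pow.
  exact/commuteV/commute_sym/pow.
have qW t : t \in W -> commute q t.
  move=> tW; rewrite /q commgEl conjXg; apply/commute_sym/commuteM.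
    exact/commuteV/commute_sym/centW.
  exact/commute_sym/centW.
(* Expanding commutators conjugates letters by powers of the [x i]; this leaves [prod_powers]
   unchanged. *)
have powJ t i k : (t ^ (x i ^+ k)) ^+ N = t ^+ N.
  by rewrite -conjXg; apply: conjg_commute.
have word_q i k : exists s, [/\ all (mem W) s,
    \prod_(t <- s) t = [~ x i ^+ k, a3] & prod_powers N s = (u i ^+ N) ^+ k].
  elim: k => [|k [s [sW es ps]]].
    by exists [::]; rewrite /prod_powers !big_nil comm1g.
  exists (u i ^ (x i ^+ k) :: s); split.
  - by rewrite /= sW andbT; apply/memW/triple_valuesJ/memW.
  - by rewrite big_cons es expgS commgMg.
  - by rewrite /prod_powers big_cons -/(prod_powers _ _) ps powJ expgS.
have word_1 k : exists s, [/\ all (mem W) s,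
    \prod_(t <- s) t = [~ a1, b ^+ k, a3] &
    prod_powers N s = \prod_(i < k) u i ^+ N].
  elim: k => [|k [s [sW es ps]]].
    by exists [::]; rewrite /prod_powers big_ord0 !big_nil commg1 comm1g.
  exists (rcons [seq t ^ x k | t <- s] (u k)); split.
  - rewrite all_rcons /= uW all_map; apply: sub_all sW => t /= tW.
    exact/memW/triple_valuesJ/memW.
  - rewrite -cats1 big_cat big_map big_seq1 -conjg_prod es /=.
    by rewrite expgS commgM -/(x k) (commgMg _ _ (x k)).
  - rewrite /prod_powers -cats1 big_cat big_map big_seq1 big_ord_recr /= -ps.
    by congr (_ * _); apply: eq_bigr => t _; rewrite -[x k]expg1 powJ.
have u_q i : u i ^+ (N * N * K) = q ^+ (N * K).
  have [s [sW es ps]] := word_q i N; rewrite qE in es.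
  by rewrite -(transfer s q) // ps -!expgnA mulnA.
have prod_u k : (\prod_(i < k) u i ^+ N) ^+ (K * N) = q ^+ (N * K * k).
  elim: k => [|k IH]; first by rewrite big_ord0 muln0 expg1n.
  rewrite big_ord_recr /= expgMn; last first.
    by apply/commute_sym/commute_prod => i _; apply/commuteX/centW.
  by rewrite IH mulnSr expgnDr -expgnA [(K * N)%N]mulnC mulnA u_q.
have [s [sW es ps]] := word_1 N.
have -> : [~ a1, b, a3] = u 0 by rewrite /u /x conjg1.
rewrite expgnA u_q -expgnA -prod_u -ps expgnA (transfer s 1) ?expg1n //.
  by rewrite es; apply/eqP/commgP/cent1.
by move=> t _; apply/commute_sym/commute1.
Qed.

End TripleCommutators.

Lemma finite_generated_triple_values (G : groupType) (A1 A2 A3 : set G) (e : nat) :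
  0 < e ->
  (forall a g, A1 a -> A1 (a ^ g)) -> (forall a g, A2 a -> A2 (a ^ g)) ->
  (forall a g, A3 a -> A3 (a ^ g)) ->
  (forall g, A1 (g ^+ e)) -> (forall g, A2 (g ^+ e)) ->
  (forall g, A3 (g ^+ e)) ->
  finite_set (triple_values A1 A2 A3) ->
  finite_set (generated_subgroup (triple_values A1 A2 A3)).
Proof.
move=> e0 A1J A2J A3J A1X A2X A3X fin.
have [n n0 tors] := triple_values_torsion A1 A2 A3 e e0 A1J A2J A3J A1X A2X A3X fin.
have /finite_seqP[W eW] := fin.
rewrite eW; apply: (@finite_generated_torsion _ W n) => // [t u tW uW|t tW].
  suff : [set` W] (t ^ u) by [].
  by rewrite -eW; apply: triple_valuesJ => //; rewrite eW.
by apply: tors; rewrite eW.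
Qed.

(** * Value sets of words *)

Section WordValues.

Context {X : choiceType} (u : freeGroup X) {G : groupType}.

Lemma eq_word_eval (g h : X -> G) : (forall x, vars u x -> g x = h x) ->
  word_eval g u = word_eval h u.
Proof.
move=> eq_gh; rewrite /word_eval big_seq [RHS]big_seq.
apply: eq_bigr => l lu; rewrite /letter_eval eq_gh //.
by rewrite /vars /=; apply/mapP; exists l.
Qed.

Lemma word_valuesJ (a h : G) : word_values u G a -> word_values u G (a ^ h).
Proof.
case=> g _ <-; exists (fun x => g x ^ h) => //.
rewrite /word_eval conjg_prod; apply: eq_bigr => -[x b] _.
by rewrite /letter_eval /=; case: b; rewrite ?conjVg.
Qed.

Lemma word_eval_single (x : X) (h : G) :
  word_eval (fun y => if y == x then h else 1) u =
  h ^+ count_mem (x, false) (fg_word u) * h ^- count_mem (x, true) (fg_word u).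
Proof.
rewrite /word_eval; elim: (fg_word u) => [|[y b] s IH].
  by rewrite big_nil expg0 invg1 mulg1.
have ch m k : commute (h ^- m) (h ^+ k).
  by apply/commute_sym/commuteV/commuteX2.
rewrite big_cons IH /letter_eval /= !xpair_eqE.
case: (y == x); last by case: b; rewrite ?invg1 mul1g.
case: b => /=; last by rewrite add0n add1n expgS mulgA.
by rewrite add0n add1n expgSr invgM !mulgA -[h^-1]/(h ^- 1) ch.
Qed.

Lemma exponent_sumE (x : X) : exponent_sum u x =
  ((count_mem (x, false) (fg_word u))%:Z - (count_mem (x, true) (fg_word u))%:Z)%R.
Proof.
rewrite /exponent_sum; elim: (fg_word u) => [|[y b] s IH]; first by rewrite big_nil.
rewrite big_cons IH /= !xpair_eqE.
case: (y == x) => //=; case: b => /=; rewrite ?add0n ?add1n -addn1 PoszD.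
  by rewrite GRing.opprD [RHS]GRing.addrA GRing.addrC.
by rewrite [RHS]GRing.addrAC GRing.addrC.
Qed.

End WordValues.

(** Setting all variables but one to [1] leaves a power of [h] whose exponent is the exponent sum;
    if that is negative, [h^-1] is substituted instead. *)
Lemma non_commutator_powers (X : choiceType) (u : freeGroup X) : non_commutator u ->
  exists2 e : nat, 0 < e & forall (G : groupType) (h : G), word_values u G (h ^+ e).
Proof.
case=> x _; rewrite exponent_sumE.
set p := count_mem _ _; set m := count_mem _ _ => ne.
have [lt_mp|lt_pm|eq_mp] := ltngtP m p; last by case: ne; rewrite eq_mp GRing.subrr.
- exists (p - m); first by rewrite subn_gt0.
  move=> G h; exists (fun y => if y == x then h else 1) => //.
  by rewrite word_eval_single expgnFr // ltnW.
- exists (m - p); first by rewrite subn_gt0.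
  move=> G h; exists (fun y => if y == x then h^-1 else 1) => //.
  rewrite word_eval_single !expVgn invgK expgnFr; last exact: ltnW.
  by apply/commute_sym/commuteV/commuteX2.
Qed.

(** Disjointness of the variables lets three independent assignments be glued into one. *)
Lemma word_values_commg3 (X : choiceType) (u1 u2 u3 : freeGroup X) (G : groupType) :
  vars u1 `&` vars u2 = set0 -> vars u1 `&` vars u3 = set0 ->
  vars u2 `&` vars u3 = set0 ->
  word_values [~ u1, u2, u3] G =
  triple_values (word_values u1 G) (word_values u2 G) (word_values u3 G).
Proof.
move=> d12 d13 d23; apply/seteqP; split=> z.
  case=> g _ <-; exists (word_eval g u1), (word_eval g u2), (word_eval g u3).
  by split; rewrite ?gmulfR; try by exists g.
case=> _ [_ [_ [[g1 _ <-] [g2 _ <-] [g3 _ <-] ->]]].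
pose g (x : X) := if x \in vars u1 then g1 x else if x \in vars u2 then g2 x else g3 x.
have disj (A B : set X) (x : X) : A `&` B = set0 -> B x -> (x \in A) = false.
  by move=> dAB Bx; apply/negP; rewrite inE => Ax; have : set0 x by rewrite -dAB.
exists g => //; rewrite !gmulfR; congr [~ _, _, _]; apply: eq_word_eval => y uy.
- by rewrite /g mem_set.
- by rewrite /g (disj _ _ _ d12 uy) mem_set.
- by rewrite /g (disj _ _ _ d13 uy) (disj _ _ _ d23 uy).
Qed.

Theorem theorem1p2 (u1 u2 u3 : freeGroup nat)
  (nc1 : non_commutator u1) (nc2 : non_commutator u2) (nc3 : non_commutator u3)
  (d12 : vars u1 `&` vars u2 = set0)
  (d13 : vars u1 `&` vars u3 = set0)
  (d23 : vars u2 `&` vars u3 = set0) :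
  concise [~ u1, u2, u3].
Proof.
move=> G; rewrite /verbal_subgroup word_values_commg3 // => fin.
have [e1 e1_gt0 X1] := non_commutator_powers _ _ nc1.
have [e2 e2_gt0 X2] := non_commutator_powers _ _ nc2.
have [e3 e3_gt0 X3] := non_commutator_powers _ _ nc3.
(* A common multiple of the exponents puts the same powers in all three value sets. *)
apply: (@finite_generated_triple_values _ _ _ _ (e1 * e2 * e3)) => //.
- by rewrite !muln_gt0 e1_gt0 e2_gt0.
- by move=> a g; apply: word_valuesJ.
- by move=> a g; apply: word_valuesJ.
- by move=> a g; apply: word_valuesJ.
- by move=> g; rewrite -mulnA mulnC expgnA; apply: X1.
- by move=> g; rewrite mulnAC expgnA; apply: X2.
- by move=> g; rewrite expgnA; apply: X3.
Qed.
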